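(* Let $G\subsetneq\mathbb{R}^2$ be a domain such that $\partial G$ satisfies the nonlinearity condition with constant $\delta\in(0,1)$. If $x,y\in G$, $x\neq y$, and $s_G(x,y)<1$, then $$v_G(x,y)>\arctan\left(\frac{\delta}{6}\,s_G(x,y)\right).$$
   Context: For a domain $G\subsetneq\mathbb{R}^n$ and $x,y\in G$, the triangular ratio metric is $s_G(x,y)=\sup_{z\in\partial G}\frac{|x-y|}{|x-z|+|z-y|}\in[0,1]$, and the visual angle metric is $v_G(x,y)=\sup\{\measuredangle(x,z,y): z\in\partial G\}$, where $\measuredangle(x,z,y)\in[0,\pi]$ is the angle at $z$ between the segments $[x,z]$ and $[y,z]$. $B(z,r)$ is the open Euclidean disk with center $z$ and radius $r$, and $d(G)\in(0,\infty]$ is the Euclidean diameter of $G$. Nonlinearity condition with constant $\delta\in(0,1)$: for every $z\in\partial G$, every $r\in(0,d(G))$ and every line $L$ with $L\cap B(z,r)\neq\emptyset$, there exists $w\in \big(B(z,r)\cap\partial G\big)\setminus\bigcup_{u\in L}B(u,\delta r)$. *)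

(* Defs.v *)
From HB Require Import structures.
From mathcomp Require Import all_boot all_order all_algebra.
From mathcomp Require Import all_classical all_reals all_analysis.

Set Implicit Arguments.
Unset Strict Implicit.
Unset Printing Implicit Defensive.

Import Order.TTheory GRing.Theory Num.Theory.
Import numFieldNormedType.Exports.

Local Open Scope classical_set_scope.
Local Open Scope ring_scope.

Section TriangularRatioVisualAngle.
Context {R : realType} {n : nat}.
Implicit Types (x y z u : 'rV[R]_n) (G L : set 'rV[R]_n).

(* The library norm on 'rV[R]_n is the sup norm, hence an explicit Euclidean
   norm; both induce the library topology, which [open], [connected],
   [closure] and [interior] refer to below. *)
Definition dotv x y : R := \sum_(i < n) x ord0 i * y ord0 i.

Definition enorm x : R := Num.sqrt (dotv x x).

Definition eball z (r : R) : set 'rV[R]_n := [set w | enorm (w - z) < r].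

Definition diam G : \bar R :=
  ereal_sup [set (enorm (p.1 - p.2))%:E | p in G `*` G].

Definition boundary G : set 'rV[R]_n := closure G `\` interior G.

Definition is_domain G : Prop := [/\ G !=set0, open G & connected G].

(* Angle at z, in [0, pi], between the segments [x, z] and [y, z]; meaningful
   for z distinct from x and y, which holds when x, y are in an open G and z is
   in its boundary. *)
Definition angle x z y : R :=
  acos (dotv (x - z) (y - z) / (enorm (x - z) * enorm (y - z))).

(* For a domain G different from the whole space, the boundary is nonempty and
   the quotients (resp. the angles) are bounded by 1 (resp. pi), so the
   following real-valued [sup]s are genuine suprema. *)
Definition triangular_ratio G x y : R :=
  sup [set enorm (x - y) / (enorm (x - z) + enorm (z - y)) | z in boundary G].

Definition visual_angle G x y : R := sup [set angle x z y | z in boundary G].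

Definition is_line L : Prop :=
  exists p u, u != 0 /\ L = [set p + t *: u | t in [set: R]].

Definition nonlinearity (delta : R) G : Prop :=
  forall z (r : R) L,
    boundary G z -> 0 < r -> (r%:E < diam G)%E ->
    is_line L -> L `&` eball z r !=set0 ->
    exists w,
      ((eball z r `&` boundary G) `\` \bigcup_(u in L) eball u (delta * r)) w.

End TriangularRatioVisualAngle.

(* Main.v *)
(** Pick [z] in the boundary nearly attaining [s_G(x,y)] and put
    [S = |x-z| + |z-y|], [d = |x-y|].  One of [x], [y] and their midpoint lies
    at distance less than [S/2] from [z], so a ball [B(z,r)] with
    [S/4 <= r < S/2] meets the line [xy], and [r < d(G)].  Nonlinearity gives
    [w] in the boundary and in [B(z,r)], at distance [h >= delta r] from the
    line.  The area of the triangle [xwy] gives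
    [tan(xwy) = d h / ((x-w).(y-w))] when the inner product is positive, and
    that product is less than [S^2].  Since [s_G(x,y) < (4/3) d/S] for a good
    choice of [z], the constant [1/6] leaves room: [S^2/6 * (4/3) d/S <= d r]. *)
Require Import Defs.
From mathcomp Require Import all_boot all_order all_algebra.
From mathcomp Require Import all_classical all_reals all_analysis.
From mathcomp Require Import ring lra.

Import Order.TTheory GRing.Theory Num.Theory.
Import numFieldNormedType.Exports.

Local Open Scope classical_set_scope.
Local Open Scope ring_scope.

Section Euclidean.
Context {R : realType} {n : nat}.
Implicit Types (a b x y z w : 'rV[R]_n) (t h r : R) (G : set 'rV[R]_n).

(** * Euclidean inner product and norm *)

Lemma dotv_sqDZ a b t :
  dotv (a + t *: b) (a + t *: b) =
  dotv a a + t * dotv a b *+ 2 + t ^+ 2 * dotv b b.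
Proof.
rewrite /dotv -mulrnAr -sumrMnl !mulr_sumr -!big_split/=.
by apply: eq_bigr => i _; rewrite !mxE; ring.
Qed.

Lemma dotvC a b : dotv a b = dotv b a.
Proof. by apply: eq_bigr => i _; rewrite mulrC. Qed.

Lemma dotvBr a b c : dotv a (b - c) = dotv a b - dotv a c.
Proof.
by rewrite /dotv -sumrB; apply: eq_bigr => i _; rewrite !mxE mulrBr.
Qed.

Lemma sqr_dotvB a b :
  dotv (b - a) (b - a) = dotv b b - dotv a b *+ 2 + dotv a a.
Proof. by rewrite dotvBr ![dotv (b - a) _]dotvC !dotvBr (dotvC b a); ring. Qed.

Lemma dotv_ge0 a : 0 <= dotv a a.
Proof. by apply: sumr_ge0 => i _; rewrite -expr2 sqr_ge0. Qed.

Lemma enorm_ge0 a : 0 <= enorm a.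
Proof. exact: sqrtr_ge0. Qed.

Lemma sqr_enorm a : enorm a ^+ 2 = dotv a a.
Proof. by rewrite sqr_sqrtr ?dotv_ge0. Qed.

Lemma enorm_gt0 a : a != 0 -> 0 < enorm a.
Proof.
move=> a0; rewrite sqrtr_gt0 lt_neqAle dotv_ge0 andbT eq_sym.
apply: contra a0 => /eqP a0; apply/eqP/rowP => i; rewrite mxE.
have: a ord0 i * a ord0 i = 0.
  apply: (psumr_eq0P (P := xpredT) _ a0) => // j _.
  by rewrite -expr2 sqr_ge0.
by move/eqP; rewrite mulf_eq0 orbb => /eqP.
Qed.

Lemma enormBC a b : enorm (a - b) = enorm (b - a).
Proof.
by rewrite /enorm; congr Num.sqrt; apply: eq_bigr => i _; rewrite !mxE; ring.
Qed.

Lemma dotv_cauchy_schwarz a b : dotv a b ^+ 2 <= dotv a a * dotv b b.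
Proof.
have [->|b0] := eqVneq b 0.
  have d0 c : dotv c 0 = 0 by apply: big1 => i _; rewrite mxE mulr0.
  by rewrite !d0 expr0n mulr0.
have bb : 0 < dotv b b by rewrite -sqr_enorm exprn_gt0// enorm_gt0.
(* This coefficient minimises the norm of [a + t *: b]. *)
have := dotv_ge0 (a + (- dotv a b / dotv b b) *: b); rewrite dotv_sqDZ.
rewrite -(pmulr_lge0 _ bb) => h; rewrite -subr_ge0; move: h.
by congr (0 <= _); field; rewrite gt_eqF.
Qed.

Lemma normr_dotv_le a b : `|dotv a b| <= enorm a * enorm b.
Proof.
rewrite -ler_sqr ?nnegrE ?mulr_ge0 ?enorm_ge0 ?normr_ge0//.
by rewrite real_normK ?num_real// exprMn !sqr_enorm dotv_cauchy_schwarz.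
Qed.

Lemma dotv_le a b : dotv a b <= enorm a * enorm b.
Proof. exact: le_trans (ler_norm _) (normr_dotv_le a b). Qed.

Lemma enorm_triangle a b : enorm (a + b) <= enorm a + enorm b.
Proof.
rewrite -ler_sqr ?nnegrE ?addr_ge0 ?enorm_ge0// sqr_enorm.
rewrite -[b in X in dotv X _]scale1r -[b in X in dotv _ X]scale1r dotv_sqDZ.
by rewrite sqrrD !sqr_enorm; have := dotv_le a b; lra.
Qed.

Lemma enorm_triangleB z x y : enorm (x - y) <= enorm (x - z) + enorm (z - y).
Proof. by rewrite -[x - y](subrKA z); exact: enorm_triangle. Qed.

(** * Euclidean balls in the library topology, boundary and diameter *)

Lemma enorm_le_norm a : enorm a <= n%:R * `|a|.
Proof.
rewrite -ler_sqr ?nnegrE ?mulr_ge0 ?enorm_ge0// sqr_enorm.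
apply: (@le_trans _ _ (n%:R * `|a| ^+ 2)); last first.
  rewrite exprMn ler_wpM2r ?sqr_ge0// -natrX ler_nat.
  by case: n => // m; rewrite expnS leq_pmulr.
have -> : n%:R * `|a| ^+ 2 = \sum_(i < n) `|a| ^+ 2.
  by rewrite sumr_const card_ord mulr_natl.
apply: ler_sum => i _; rewrite -expr2 -real_normK ?num_real//.
rewrite lerXn2r ?nnegrE//.
rewrite [`|a|]mx_normrE.
exact: (le_bigmax _ (fun ij : 'I_1 * 'I_n => `|a ij.1 ij.2|) (ord0, i)).
Qed.

Lemma closure_eball G z r : closure G z -> 0 < r -> G `&` eball z r !=set0.
Proof.
move=> Gz r0; have e0 : 0 < r / n.+1%:R by rewrite divr_gt0.
have [w [Gw]] := Gz _ (nbhsx_ballx z _ e0).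
rewrite -ball_normE/= => zw; exists w; split => //.
rewrite /eball/= enormBC (le_lt_trans (enorm_le_norm _))//.
rewrite (@le_lt_trans _ _ (n.+1%:R * `|z - w|)) ?ler_wpM2r ?ler_nat//.
by rewrite mulrC -ltr_pdivlMr.
Qed.

(** Without boundary, [G] would be clopen. So would its preimage under the line from a point of [G]
    to a point outside, against the connectedness of the reals. *)
Lemma boundary_nonempty G : G !=set0 -> open G -> G != setT ->
  boundary G !=set0.
Proof.
move=> [a Ga] oG GT; apply/set0P/negP => /eqP bd0.
have cG : closed G.
  move=> z cz; apply: contrapT => nGz.
  have : boundary G z by split => // /interior_subset.
  by rewrite bd0.
have [b nGb] : ~` G !=set0.
  by apply/set0P; apply: contra GT => /eqP G0; rewrite -[G]setCK G0 setC0.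
pose f t := a + t *: (b - a).
have cf : continuous f.
  move=> t; apply: cvgD; first exact: cvg_cst.
  by apply: cvgZr_tmp; exact: cvg_id.
have cT : connected [set: R] by apply/connected_intervalP => ? ? ? ? ?.
suff : f @^-1` G = setT.
  move/seteqP => -[_ /(_ 1 I)]; rewrite /f/= scale1r addrC subrK.
  exact: nGb.
apply: cT.
- by exists 0; rewrite /f/= scale0r addr0.
- exists (f @^-1` G); last by rewrite setTI.
  by apply: open_comp => // ? _; exact: cf.
- exists (f @^-1` G); last by rewrite setTI.
  by apply: preimage_closed => // ? _; exact: cf.
Qed.

(** The strict inequality leaves room to replace [z] by a nearby point of [G]. *)
Lemma lt_diam G x z r : G x -> closure G z -> r < enorm (x - z) ->
  (r%:E < diam G)%E.
Proof.
move=> Gx cz rz; have e0 : 0 < enorm (x - z) - r by rewrite subr_gt0.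
have [w [Gw zw]] := closure_eball G z _ cz e0.
apply: (@lt_le_trans _ _ (enorm (x - w))%:E).
  by rewrite lte_fin; have := enorm_triangleB w x z; rewrite /eball/= in zw; lra.
by apply: ereal_sup_ubound; exists (x, w).
Qed.

(** * Distances from a point to a line *)

Lemma line_near_focal_mean x y z : x != y ->
  exists t, enorm (x + t *: (y - x) - z) < (enorm (x - z) + enorm (z - y)) / 2.
Proof.
move=> xy; rewrite (enormBC z y); set a := x - z; set b := y - z.
have [ab|ba|ab] := ltgtP (enorm a) (enorm b).
- by exists 0; rewrite scale0r addr0 -/a; lra.
- exists 1; rewrite scale1r [x + _]addrC subrK -/b; lra.
(* For equal distances, the midpoint is strictly closer by the parallelogram law, since [x != y]. *)
exists (2^-1); rewrite addrAC -/a.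
have -> : y - x = b - a by rewrite /a /b opprB addrA subrK.
have ba0 : 0 < dotv (b - a) (b - a).
  rewrite -sqr_enorm exprn_gt0// enorm_gt0// /a /b opprB addrA subrK.
  by rewrite subr_eq0 eq_sym.
have -> : (enorm a + enorm b) / 2 = enorm a by rewrite -ab; lra.
rewrite -ltr_sqr ?nnegrE ?enorm_ge0// !sqr_enorm dotv_sqDZ.
move: ba0 (sqr_enorm a) (sqr_enorm b); rewrite -ab => + ->.
rewrite (dotvBr a b a) sqr_dotvB.
lra.
Qed.

(** The right-hand side is the Gram determinant, the squared double area of the triangle with
    vertices [0], [a], [b]; its base is [b - a] and its height at least [h]. *)
Lemma gram_ge_dist a b h : 0 <= h ->
  (forall t, h <= enorm (a + t *: (b - a))) ->
  (h * enorm (b - a)) ^+ 2 <= dotv a a * dotv b b - dotv a b ^+ 2.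
Proof.
move=> h0 hd; rewrite exprMn sqr_enorm.
have [ba|ba] := eqVneq (b - a) 0.
  have -> : dotv (b - a) (b - a) = 0.
    by rewrite ba; apply: big1 => i _; rewrite mxE mulr0.
  by rewrite mulr0 subr_ge0 dotv_cauchy_schwarz.
have e0 : 0 < dotv (b - a) (b - a) by rewrite -sqr_enorm exprn_gt0// enorm_gt0.
(* The foot of the perpendicular from the origin. *)
have := hd (- dotv a (b - a) / dotv (b - a) (b - a)).
rewrite -ler_sqr ?nnegrE ?enorm_ge0// sqr_enorm dotv_sqDZ.
rewrite -(ler_pM2r e0) => /le_trans; apply.
rewrite le_eqVlt; apply/orP; left; apply/eqP.
transitivity (dotv a a * dotv (b - a) (b - a) - dotv a (b - a) ^+ 2).
  by field; rewrite gt_eqF.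
rewrite (dotvBr a b a) sqr_dotvB.
ring.
Qed.

(** * Comparing arctangent and arccosine *)

Lemma cos_angle_bound a b : -1 <= dotv a b / (enorm a * enorm b) <= 1.
Proof.
rewrite -ler_norml normrM normfV [X in _ / X]ger0_norm ?mulr_ge0 ?enorm_ge0//.
have := normr_dotv_le a b; set p := _ * _ => dp.
(* A zero denominator makes the quotient 0. *)
have [p0|p0] := eqVneq p 0; first by rewrite p0 invr0 mulr0.
by rewrite ler_pdivrMr ?mul1r// lt_neqAle eq_sym p0/= mulr_ge0 ?enorm_ge0.
Qed.

(** Cosine decreases on [[0, pi]], and [cos (atan t)] is [1 / sqrt (1 + t^2)]. *)
Lemma atan_lt_acos t (c : R) : 0 < t -> -1 <= c <= 1 ->
  c * Num.sqrt (1 + t ^+ 2) < 1 -> atan t < acos c.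
Proof.
move=> t0 c1 ct; have s0 : 0 < Num.sqrt (1 + t ^+ 2).
  by rewrite sqrtr_gt0 ltr_wpDr ?sqr_ge0.
have at0 : 0 <= atan t by rewrite -[leLHS]atan0; apply: le_atan; exact: ltW.
rewrite -ltr_cos ?in_itv/=.
- by rewrite acosK ?in_itv// cos_atan -[_^-1]mul1r ltr_pdivlMr.
- rewrite at0/= (le_trans (ltW (atan_ltpi2 t)))//.
  by rewrite ler_pdivrMr// ler_peMr ?pi_ge0 ?ler1n.
- by rewrite acos_ge0//= acos_lepi.
Qed.

(* [g] is a lower bound of [|a||b| sin] for the angle between [a] and [b]. *)
Lemma atan_lt_acos_dotv t g a b : 0 < t -> 0 < g ->
  g ^+ 2 <= dotv a a * dotv b b - dotv a b ^+ 2 -> t * dotv a b < g ->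
  atan t < acos (dotv a b / (enorm a * enorm b)).
Proof.
move=> t0 g0 ga tg; apply: atan_lt_acos (cos_angle_bound a b) _ => //.
have s0 : 0 < Num.sqrt (1 + t ^+ 2).
  by rewrite sqrtr_gt0 ltr_wpDr ?sqr_ge0.
have := normr_dotv_le a b; set p := _ * _ => dp.
have p2 : p ^+ 2 = dotv a a * dotv b b by rewrite exprMn !sqr_enorm.
have p0 : 0 < p.
  rewrite lt_neqAle mulr_ge0 ?enorm_ge0// andbT eq_sym; apply/eqP => p0.
  move: ga; rewrite -p2 p0 expr0n/= leNgt sub0r.
  by rewrite (@le_lt_trans _ _ 0) ?exprn_gt0// oppr_le0 sqr_ge0.
rewrite mulrAC ltr_pdivrMr// mul1r.
have [d0|d0] := leP (dotv a b) 0.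
  by rewrite (le_lt_trans _ p0)// mulr_le0_ge0// ltW.
rewrite -ltr_sqr ?nnegrE ?mulr_ge0 ?enorm_ge0 ?(ltW s0) ?(ltW d0)//.
rewrite p2 exprMn sqr_sqrtr ?addr_ge0 ?sqr_ge0//.
(* The goal, squared, is [(1 + t^2) (a.b)^2 < |a|^2 |b|^2]; the bound on [g ^+ 2] reduces it to
   this. *)
have : (t * dotv a b) ^+ 2 < g ^+ 2.
  by rewrite ltr_sqr ?nnegrE ?mulr_ge0 ?(ltW t0) ?(ltW d0) ?(ltW g0).
rewrite exprMn; lra.
Qed.

(** * Suprema over the boundary and the final estimate *)

Lemma angle_le_visual_angle G x y z : boundary G z ->
  angle x z y <= visual_angle G x y.
Proof.
move=> Gz; apply: ub_le_sup; last by exists z.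
by exists pi => _ [w _ <-]; exact: acos_lepi (cos_angle_bound _ _).
Qed.

Lemma triangular_ratio_adherent G x y t : boundary G !=set0 -> x != y -> t < 1 ->
  0 < triangular_ratio G x y /\ exists2 z, boundary G z &
    t * triangular_ratio G x y < enorm (x - y) / (enorm (x - z) + enorm (z - y)).
Proof.
move=> [z0 Gz0] xy t1.
have d0 : 0 < enorm (x - y) by rewrite enorm_gt0 // subr_eq0.
have S0 z : 0 < enorm (x - z) + enorm (z - y).
  exact: lt_le_trans d0 (enorm_triangleB _ _ _).
have hs : has_sup [set enorm (x - y) / (enorm (x - z) + enorm (z - y))
    | z in boundary G].
  split; first by exists (enorm (x - y) / (enorm (x - z0) + enorm (z0 - y))), z0.
  by exists 1 => _ [z _ <-]; rewrite ler_pdivrMr// mul1r enorm_triangleB.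
have s0 : 0 < triangular_ratio G x y.
  apply: (@lt_le_trans _ _ (enorm (x - y) / (enorm (x - z0) + enorm (z0 - y)))).
    exact: divr_gt0.
  by apply: sup_upper_bound => //; exists z0.
split => //.
(* The gap between the supremum and [t] times it. *)
have e0 : 0 < (1 - t) * triangular_ratio G x y by rewrite mulr_gt0// subr_gt0.
have [_ [z Gz <-] sz] := sup_adherent e0 hs; exists z => //.
by move: sz; rewrite -/(triangular_ratio G x y) mulrBl mul1r subKr.
Qed.

Theorem atan_lt_visual_angle G (delta : R) x y : is_domain G -> G != setT ->
  0 < delta -> nonlinearity delta G -> G x -> G y -> x != y ->
  atan (delta / 6 * triangular_ratio G x y) < visual_angle G x y.
Proof.
move=> [G0 oG _] GT del0 nlG Gx Gy xy.
have t1 : 3 / 4 < 1 :> R by lra.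
have [s0 [z Gz]] := triangular_ratio_adherent G x y _
  (boundary_nonempty _ G0 oG GT) xy t1.
set s := triangular_ratio G x y in s0 *; set S := enorm (x - z) + enorm (z - y).
have d0 : 0 < enorm (x - y) by rewrite enorm_gt0 // subr_eq0.
have S0 : 0 < S by exact: lt_le_trans d0 (enorm_triangleB _ _ _).
rewrite ltr_pdivlMr// => sS.
have [t] := line_near_focal_mean x y z xy; rewrite -/S.
set u := x + t *: (y - x) => uz; have u0 := enorm_ge0 (u - z).
(* Halfway between [|u - z|] and [S / 2], so that [u] lies in the ball and [r < S / 2]. *)
pose r := (enorm (u - z) + S / 2) / 2.
have rS : S / 4 <= r by rewrite /r; lra.
have Sr : r < S / 2 by rewrite /r; lra.
have ur : enorm (u - z) < r by rewrite /r; lra.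
have r0 : 0 < r by lra.
have cz : closure G z by case: Gz.
have rG : (r%:E < diam G)%E.
  (* As [2 r < S], at least one of [x], [y] is farther than [r] from [z]. *)
  have [xz|xz] := ltP r (enorm (x - z)); first exact: lt_diam Gx cz xz.
  by apply: lt_diam Gy cz _; rewrite enormBC; move: Sr; rewrite /S; lra.
pose L : set 'rV[R]_n := [set x + t *: (y - x) | t in [set: R]].
have lL : is_line L by exists x, (y - x); rewrite subr_eq0 eq_sym xy.
have [w [[zw Gw] wL]] : exists w,
    ((eball z r `&` boundary G) `\` \bigcup_(u in L) eball u (delta * r)) w.
  by apply: nlG => //; exists u; split => //; exists t.
apply: lt_le_trans (angle_le_visual_angle G x y w Gw).
have dr0 : 0 < delta * r by rewrite mulr_gt0.
have eyx : y - w - (x - w) = y - x by rewrite opprB addrA subrK.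
apply: (@atan_lt_acos_dotv _ (delta * r * enorm (x - y))).
- by rewrite mulr_gt0// divr_gt0.
- by rewrite mulr_gt0.
- rewrite enormBC -eyx; apply: gram_ge_dist; first exact: ltW.
  move=> t'; rewrite eyx leNgt; apply/negP => wt.
  apply: wL; exists (x + t' *: (y - x)); first by exists t'.
  by rewrite /eball/= enormBC addrAC.
have wxy : dotv (x - w) (y - w) < S ^+ 2.
  rewrite /eball/= in zw.
  apply: (le_lt_trans (dotv_le _ _)).
  have := enorm_triangleB z x w; have := enorm_triangleB z y w.
  rewrite (enormBC z w) (enormBC y z) => yw xw.
  (* The sum is below [S + 2 r]; the inequality of means then bounds the product by [S ^+ 2]. *)
  have AB : enorm (x - w) + enorm (y - w) < 2 * S.
    by move: Sr zw xw yw S0; rewrite /S; lra.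
  have := enorm_ge0 (x - w); have := enorm_ge0 (y - w).
  have := sqr_ge0 (enorm (x - w) - enorm (y - w)).
  by move: AB S0; nra.
have [D0|D0] := leP (dotv (x - w) (y - w)) 0.
  apply: (@le_lt_trans _ _ 0); last by rewrite mulr_gt0.
  by rewrite mulr_ge0_le0// ltW// mulr_gt0// divr_gt0.
apply: (@le_lt_trans _ _ (delta / 6 * s * S ^+ 2)).
  by rewrite ler_wpM2l ?ltW// mulr_gt0// divr_gt0.
have -> : delta / 6 * s * S ^+ 2 = delta * S * (s * S) / 6 by field.
apply: (@lt_le_trans _ _ (delta * S * enorm (x - y) * (4 / 3) / 6)).
  rewrite ltr_pM2r ?invr_gt0// -[ltRHS]mulrA ltr_pM2l ?mulr_gt0//; lra.
have -> : delta * S * enorm (x - y) * (4 / 3) / 6 =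
  delta * enorm (x - y) * (2 / 9 * S) by field.
(* Here [2/9 < 1/4] and [S / 4 <= r]. *)
rewrite [leRHS]mulrAC ler_wpM2l ?mulr_ge0 ?ltW//; lra.
Qed.

End Euclidean.

Theorem theorem3p3 (R : realType) (G : set 'rV[R]_2) (delta : R)
    (domG : is_domain G) (GnT : G != setT)
    (delta_gt0 : 0 < delta) (delta_lt1 : delta < 1)
    (nlG : nonlinearity delta G)
    (x y : 'rV[R]_2) (Gx : G x) (Gy : G y) (xy : x != y)
    (s_lt1 : triangular_ratio G x y < 1) :
  atan (delta / 6 * triangular_ratio G x y) < visual_angle G x y.
Proof. exact: atan_lt_visual_angle. Qed.
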